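(* Let $\Psi: \{1,\dots,7\} \to \mathbb{Z}_{>0}$ be a function such that for every $j \in \{1,\dots,7\}$, every $n \geq \Psi(j)$ and every transitive subgroup $H$ of $S_n$ with $H \neq A_n$ and $H \neq S_n$, one has $m(H) \leq n - j$. Let $k \leq 5$ be a positive integer and let $n \in \mathbb{N}$ with $n \geq \Psi(k+2)$. Suppose that $\{h_1, \dots, h_{n-k}\}$ is an irredundant generating set of $S_n$ of size $n-k$. Then $d(h_i) \leq k+1$ for every $i$. Moreover, if $d(h_i) = k+1$, then $h_i$ is an even permutation.
   Context: For a finite group $G$, a set $\{g_1,\dots,g_r\}$ of elements of $G$ is irredundant if for every $j$ the subgroup $\langle g_i : i \neq j\rangle$ is different from $\langle g_1,\dots,g_r\rangle$; it is an irredundant generating set of $G$ if moreover it generates $G$. $m(G)$ denotes the maximal size of an irredundant generating set of $G$. For a cycle $c = (u_1\,u_2\,\dots\,u_s) \in S_n$ put $d(c) = s-1$; for $x \in S_n$ with disjoint cycle decomposition $x = c_1 c_2 \cdots c_p$ put $d(x) = \sum_{i=1}^p d(c_i)$. *)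

(* Defs.v *)
From mathcomp Require Import all_boot all_fingroup all_solvable.

Set Implicit Arguments.
Unset Strict Implicit.
Unset Printing Implicit Defensive.

Local Open Scope group_scope.

Definition irredundant (gT : finGroupType) (X : {set gT}) : bool :=
  [forall x in X, <<X :\ x>> != <<X>>].

Definition irredundant_generating (gT : finGroupType) (G X : {set gT}) : bool :=
  irredundant X && (<<X>> == G).

(* The maximum over the empty range would be 0, but a finite group always has
   an irredundant generating set, so for G a group this is a true maximum. *)
Definition max_irredundant (gT : finGroupType) (G : {group gT}) : nat :=
  \max_(X : {set gT} | irredundant_generating G X) #|X|.

(* The cycles of the disjoint cycle decomposition of x are represented by their
   supports, the elements of [porbits x]; fixed points occur there as
   singletons and contribute 0. *)
Definition perm_depth (T : finType) (x : {perm T}) : nat :=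
  \sum_(c in porbits x) (#|c| - 1)%N.

(* Main.v *)
Require Import Defs.
From mathcomp Require Import all_boot all_fingroup all_solvable.

(** Deleting one element [x] from the irredundant generating set [X] leaves a
    proper subgroup of [S_n] with an irredundant generating set of size
    [n - k - 1], so the bound for [j = k + 2] forces [<<X :\ x>>] to be either
    intransitive or [A_n].  The second case occurs for at most one [x], as two
    such elements would make every member of [X] even.

    Now count orbits.  The group generated by [h] alone has [n - d(h)] orbits on
    the [n] points.  Adjoin the remaining elements of [X] one by one: if
    [<<X :\ x>>] is intransitive, then adjoining [x] must merge two orbits, for
    otherwise [x] would preserve all orbits of the larger group [<<X :\ x>>], and
    [X] would not generate a transitive group ([card_orbits_adjoin_cut]).  At
    least one orbit is left at the end.

    If every [x != h] in [X] has this merging property, then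
    [1 + (n - k - 1) <= n - d(h)], that is, [d(h) <= k].  Otherwise
    [<<X :\ j>> = A_n] for exactly one [j != h]; then [h] lies in [A_n], and
    leaving [j] out of the count gives [d(h) <= k + 1]. *)

Set Implicit Arguments.
Unset Strict Implicit.
Unset Printing Implicit Defensive.

Local Open Scope group_scope.

Definition orbits (T : finType) (G : {set {perm T}}) : {set {set T}} :=
  orbit 'P G @: [set: T].

Lemma perm_acts_setT (T : finType) (G : {set {perm T}}) :
  [acts G, on [set: T] | 'P].
Proof.
by apply/subsetP=> g _; rewrite !inE /=; apply/subsetP=> x _; rewrite !inE.
Qed.

Lemma orbitS (T : finType) (G K : {set {perm T}}) (x : T) :
  G \subset K -> orbit 'P G x \subset orbit 'P K x.
Proof. exact: imsetS. Qed.

Lemma perm_depth_orbits (T : finType) (h : {perm T}) :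
  (perm_depth h + #|orbits <[h]>| = #|T|)%N.
Proof.
have part : partition (orbits <[h]>) [set: T].
  exact: orbit_partition (@perm_acts_setT T <[h]>).
have ->: perm_depth h = \sum_(c in orbits <[h]>) (#|c| - 1)%N.
  apply: eq_bigl => c.
  by apply/imsetP/imsetP=> -[x _ ->]; exists x; rewrite ?inE // porbit.unlock.
rewrite -cardsT (card_partition part) -sum1_card -big_split /=.
apply: eq_bigr => c cP; rewrite subnK // card_gt0.
by apply: contraTneq cP => ->; case/and3P: part.
Qed.

(** Every orbit of the larger group is the saturation of an orbit of the
    smaller one, and the counts agree only if saturation is injective. *)
Lemma card_orbits_leqif (T : finType) (G K : {group {perm T}}) :
  G \subset K ->
  #|orbits K| <= #|orbits G| ?= iff [forall x, orbit 'P K x == orbit 'P G x].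
Proof.
move=> sGK.
pose sat (O : {set T}) := \bigcup_(y in O) orbit 'P K y.
have satE x : sat (orbit 'P G x) = orbit 'P K x.
  apply/eqP; rewrite eqEsubset; apply/andP; split.
    apply/bigcupsP=> y /(subsetP (orbitS x sGK)) yKx.
    by rewrite (orbit_eqP yKx).
  exact: (bigcup_sup x (orbit_refl _ _ _)).
have ->: orbits K = sat @: orbits G.
  by rewrite /orbits -imset_comp; apply: eq_imset => x /=; rewrite satE.
split; first exact: leq_imset_card.
apply/imset_injP/forallP=> [inj_sat x | eqKG _ _ /imsetP[x _ ->] /imsetP[y _ ->]].
  apply/eqP/setP=> y; apply/idP/idP=> [yKx|]; last first.
    exact: (subsetP (orbitS x sGK)).
  apply/orbit_eqP; apply: inj_sat; rewrite ?imset_f ?inE // !satE.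
  exact/orbit_eqP.
by rewrite !satE (eqP (eqKG x)) (eqP (eqKG y)).
Qed.

(** If no orbits of [<<A>>] were merged, [x] would preserve the orbits of
    [<<A>>], hence those of [<<L>>], which are unions of orbits of [<<A>>]; then
    [<<x |: L>>] could not be transitive without [<<L>>] being so. *)
Lemma card_orbits_adjoin_cut (T : finType) (x : {perm T}) (A L : {set {perm T}}) :
    A \subset L -> [transitive <<x |: L>>, on [set: T] | 'P] ->
    ~~ [transitive <<L>>, on [set: T] | 'P] ->
  #|orbits <<x |: A>>| < #|orbits <<A>>|.
Proof.
move=> sAL trXL; apply: contraR.
have sAxA : <<A>> \subset <<x |: A>> by rewrite genS ?subsetUr.
rewrite (ltn_leqif (card_orbits_leqif sAxA)) negbK.
move/forallP=> eq_orbb.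
have eq_orb y : orbit 'P <<x |: A>> y = orbit 'P <<A>> y by apply/eqP/eq_orbb.
have x_stab y : 'P%act y x \in orbit 'P <<L>> y.
  apply: (subsetP (orbitS y (genS sAL))).
  by rewrite -eq_orb mem_orbit // mem_gen ?setU11.
have sXLN y : <<x |: L>> \subset 'N(orbit 'P <<L>> y | 'P).
  rewrite gen_subG; apply/subsetP=> g /setU1P gxL.
  apply/astabsP=> z; apply: orbit_transl.
  case: gxL => [-> | Lg]; first exact: x_stab.
  by rewrite mem_orbit ?mem_gen.
have /imsetP[y _ orb_y] := trXL.
apply/imsetP; exists y; rewrite ?inE //.
apply/eqP; rewrite eq_sym eqEsubset subsetT orb_y.
by rewrite acts_sub_orbit ?orbit_refl.
Qed.

Lemma card_orbits_adjoin_cuts (T : finType) (X A B : {set {perm T}}) :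
    [transitive <<X>>, on [set: T] | 'P] ->
    A \subset X -> B \subset X -> [disjoint A & B] ->
    {in B, forall x, ~~ [transitive <<X :\ x>>, on [set: T] | 'P]} ->
  #|orbits <<A :|: B>>| + #|B| <= #|orbits <<A>>|.
Proof.
move=> trX; move: {2}#|B| (erefl #|B|) => m.
elim: m A B => [|m IHm] A B cardB sAX sBX dAB cutB.
  by rewrite (cards0_eq cardB) setU0 cards0 addn0.
have [x Bx] : exists x, x \in B by apply/card_gt0P; rewrite cardB.
have Xx := subsetP sBX x Bx.
have sB'B : B :\ x \subset B by rewrite subD1set.
rewrite (cardsD1 x) Bx in cardB *.
have notAx : x \notin A by rewrite (disjointFl dAB).
have ltA : #|orbits <<x |: A>>| < #|orbits <<A>>|.
  apply: (@card_orbits_adjoin_cut _ x A (X :\ x)); last exact: cutB.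
  - by rewrite subsetD1 sAX.
  - by rewrite setD1K.
apply: leq_trans ltA; rewrite addnCA add1n ltnS.
have ->: A :|: B = (x |: A) :|: (B :\ x).
  by rewrite -{1}(setD1K Bx) setUCA setUA.
apply: IHm.
- by case: cardB.
- by rewrite subUset sub1set Xx.
- exact: subset_trans sBX.
- rewrite -setI_eq0 setIUl setU_eq0 !setI_eq0 disjoints1 !inE eqxx /=.
  exact: disjointWr dAB.
- by move=> y /(subsetP sB'B)/cutB.
Qed.

(** Starting from the [#|T| - perm_depth h] orbits of [h], each element of [B]
    merges at least two orbits, and at least one orbit is left. *)
Lemma perm_depth_cuts (T : finType) (X B : {set {perm T}}) (h : {perm T}) :
    0 < #|T| -> [transitive <<X>>, on [set: T] | 'P] ->
    h \in X -> B \subset X :\ h ->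
    {in B, forall x, ~~ [transitive <<X :\ x>>, on [set: T] | 'P]} ->
  perm_depth h + #|B| < #|T|.
Proof.
move=> T_gt0 trX Xh; rewrite subsetD1 => /andP[sBX notBh] cutB.
have := @card_orbits_adjoin_cuts _ X [set h] B trX.
rewrite sub1set disjoints1 => /(_ Xh sBX notBh cutB) leB.
rewrite -(perm_depth_orbits h) -addnS leq_add2l.
apply: leq_trans leB; rewrite -add1n leq_add2r card_gt0.
have [t _] := card_gt0P T_gt0.
by apply/set0Pn; exists (orbit 'P <<h |: B>> t); rewrite imset_f ?inE.
Qed.

Lemma irredundantD1 (gT : finGroupType) (X : {set gT}) (x : gT) :
  irredundant X -> irredundant (X :\ x).
Proof.
move/forall_inP=> irrX; apply/forall_inP=> y /setD1P[neq_yx Xy].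
apply: contraNneq (irrX y Xy) => eq_gen.
rewrite eqEsubset genS ?subD1set //= gen_subG.
apply/subsetP=> z Xz; have [->|neq_zy] := eqVneq z y; last first.
  by rewrite mem_gen // !inE neq_zy.
have: y \in <<X :\ x>> by rewrite mem_gen // !inE neq_yx.
by rewrite -eq_gen; apply/subsetP/genS; rewrite setSD ?subD1set.
Qed.

Lemma irredundant_card_leq_max (gT : finGroupType) (X : {set gT}) :
  irredundant X -> #|X| <= max_irredundant <<X>>.
Proof.
move=> irrX; rewrite /max_irredundant.
apply: (@leq_bigmax_cond _ _ (fun Y : {set gT} => #|Y|)).
by rewrite /irredundant_generating irrX /=.
Qed.

Lemma card_gt1_perm_neq1 (T : finType) (h : {perm T}) : h != 1 -> 1 < #|T|.
Proof.
apply: contraNltn => T_le1; apply/eqP/permP=> x.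
exact: (fintype_le1P T_le1).
Qed.

(** An odd permutation exists, so [X] has an odd member [z]; each of [i] and [j]
    has to be [z], as otherwise [z] would be in the generated alternating group. *)
Lemma gen_Sym_Alt_inj (T : finType) (X : {set {perm T}}) (i j : {perm T}) :
    1 < #|T| -> <<X>> = 'Sym_T ->
    <<X :\ i>> = 'Alt_T -> <<X :\ j>> = 'Alt_T ->
  i = j.
Proof.
move=> T_gt1 genX Ai Aj.
have evenD1 y w : <<X :\ y>> = 'Alt_T -> w \in X -> w != y -> w \in 'Alt_T.
  by move=> <- Xw neq_wy; rewrite mem_gen // !inE neq_wy.
have [z Xz oddz] : exists2 z, z \in X & z \notin 'Alt_T.
  apply/subsetPn; rewrite -gen_subG genX.
  apply/negP=> /subset_leq_card; rewrite leqNgt -(Lagrange (Alt_subset T)).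
  by rewrite (Alt_index T_gt1) ltn_Pmulr ?cardG_gt0.
have {}evenD1 y : <<X :\ y>> = 'Alt_T -> z = y.
  by move=> Ay; apply/eqP; apply: contraNT oddz; apply: evenD1.
by rewrite -(evenD1 i Ai) -(evenD1 j Aj).
Qed.

Theorem theorem8 (Psi : nat -> nat)
  (Psi_gt0 : forall j : nat, (1 <= j <= 7)%N -> (0 < Psi j)%N)
  (PsiP : forall j : nat, (1 <= j <= 7)%N ->
     forall n : nat, (Psi j <= n)%N ->
     forall H : {group 'S_n}, [transitive H, on [set: 'I_n] | 'P] ->
     H :!=: 'Alt_('I_n) -> H :!=: 'Sym_('I_n) ->
     (max_irredundant H + j <= n)%N)
  (k : nat) (k_gt0 : (0 < k)%N) (k_le5 : (k <= 5)%N)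
  (n : nat) (le_Psi_n : (Psi (k + 2)%N <= n)%N)
  (X : {set 'S_n}) (cardX : (#|X| + k)%N = n)
  (irrX : irredundant_generating 'Sym_('I_n) X) :
  forall h : 'S_n, h \in X ->
    (perm_depth h <= k + 1)%N /\ (perm_depth h = (k + 1)%N -> ~~ odd_perm h).
Proof.
move=> h Xh; have /andP[irr /eqP genX] := irrX.
(* The identity is redundant in every generating set, so [h != 1]. *)
have n_gt1 : 1 < #|'I_n|.
  apply: (@card_gt1_perm_neq1 _ h).
  apply: contraNneq (forall_inP irr h Xh) => ->.
  rewrite eqEsubset genS ?subD1set //= gen_subG.
  apply/subsetP=> z Xz; have [->|neq_z1] := eqVneq z 1; first exact: group1.
  by rewrite mem_gen // !inE neq_z1.
have trX : [transitive <<X>>, on [set: 'I_n] | 'P].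
  by rewrite genX; apply: (ntransitive1 (ltnW n_gt1)); apply: Sym_trans.
have cardXD1 x : x \in X -> #|X :\ x| + k.+1 = n.
  by move=> Xx; move: cardX; rewrite (cardsD1 x X) Xx add1n addnS.
have trAlt x : x \in X -> [transitive <<X :\ x>>, on [set: 'I_n] | 'P] ->
    <<X :\ x>> = 'Alt_('I_n).
  move=> Xx tr_x; apply/eqP; apply: contraT => notAlt.
  have k2 : 1 <= k + 2 <= 7 by rewrite addn2 /= !ltnS.
  have max_le := PsiP _ k2 n le_Psi_n [group of <<X :\ x>>] tr_x notAlt.
  rewrite -genX in max_le; have {max_le} := max_le (forall_inP irr x Xx).
  have max_ge := irredundant_card_leq_max (irredundantD1 x irr).
  move/(leq_trans (leq_add max_ge (leqnn (k + 2)))).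
  by rewrite addn2 addnS cardXD1 // ltnn.
have depth_bound := perm_depth_cuts (ltnW n_gt1) trX Xh.
have [cut_h|] := boolP [forall x in X :\ h,
    ~~ [transitive <<X :\ x>>, on [set: 'I_n] | 'P]].
  have lt_h := depth_bound _ (subxx _) (forall_inP cut_h).
  have le_hk : perm_depth h <= k.
    move: lt_h; rewrite card_ord -[ltnRHS](cardXD1 h Xh).
    by rewrite addnC ltn_add2l ltnS.
  by rewrite addn1; split=> [|eq_h]; [apply: leqW | rewrite eq_h ltnn in le_hk].
case/forall_inPn=> j /setD1P[neq_jh Xj] /negPn tr_j.
have Aj := trAlt j Xj tr_j.
have cutB : {in X :\ h :\ j,
    forall x, ~~ [transitive <<X :\ x>>, on [set: 'I_n] | 'P]}.
  move=> x /setD1P[neq_xj /setD1P[_ Xx]].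
  apply: contraNN neq_xj => /(trAlt x Xx) Ax.
  exact/eqP/(gen_Sym_Alt_inj n_gt1 genX Ax Aj).
have lt_h := depth_bound _ (subD1set _ _) cutB.
split.
  move: lt_h; rewrite card_ord -[ltnRHS](cardXD1 h Xh) (cardsD1 j) !inE neq_jh Xj.
  by rewrite addnC add1n addSnnS ltn_add2l addn1 ltnS.
have : h \in 'Alt_('I_n).
  by rewrite -Aj mem_gen // !inE eq_sym neq_jh.
by rewrite Alt_even.
Qed.
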